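(* Let $T$ be a cell of dimension $d$ and let $A^k(T)$ be the lowest order space. For $u\in A^k(T)$, the integrals $\int_T u\wedge a'$ against constant forms $a'\in \mathrm{P}^0\Lambda^{d-k}(T)$ can be computed recursively from the degrees of freedom of $u$, i.e. from the integrals of $u$ on the $k$-dimensional faces of $T$.
   Context: $T$ denotes a polytope (a flat cell of a polytopal mesh) of dimension $d$, oriented and equipped with the Euclidean metric. Its faces $T'$ include $T$ itself; each face is also a cell, and is oriented. Differential forms are real valued; the trace $u|_{T'}$ of a form $u$ on a face $T'$ is its pullback by the inclusion $T' \to T$. $X^k(T)$ is the space of $k$-forms $u$ in $L^2(T)$ with $\mathrm{d}u$ in $L^2(T)$, and $X^k_0(T)=\{u\in X^k(T): u|_{\partial T}=0\}$ (so $X^d_0(T)=X^d(T)$). The pointwise scalar product of forms is $u\cdot v$; orthogonality $\perp$ is with respect to the $L^2$ scalar product. $\mathrm{P}^s\Lambda^k(T)$ is the space of polynomial $k$-forms of degree at most $s$. With $b_T$ the barycentre of $T$, $\kappa_T$ denotes contraction of forms by the vector field $x\mapsto x-b_T$, and $\mathrm{P}^s_-\Lambda^k(T)=\{u\in \mathrm{P}^s\Lambda^k(T): \kappa_T u\in \mathrm{P}^s\Lambda^{k-1}(T)\}$. Spaces of $k$-forms with $k<0$ or $k>d$ are zero. For $d\ge 1$: $W^k(T)=\mathrm{P}^1_-\Lambda^k(T)$ for $k\geq 1$, and $W^0(T)$ is the space of those $w\in \mathrm{P}^1_-\Lambda^0(T)=\mathrm{P}^1(T)$ with integral $0$ on $T$.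 Set $$Z^k_0(T)=\{u\in X^k_0(T): \forall w\in W^{d-k}(T)\ \int_T u\wedge w=0\},\qquad Y^k(T)=\{u\in Z^k_0(T): u\perp \mathrm{d}Z^{k-1}_0(T)\}.$$ $B^k(T)$ is the space of $u\in X^k(T)$ for which there exist $a\in \mathrm{P}^0\Lambda^{d-k}(T)$, $b\in \mathrm{P}^0\Lambda^{d-k+1}(T)$ and $v\in Y^{k-1}(T)$ such that $$\int_T \mathrm{d}u\cdot \mathrm{d}u' + \int_T \mathrm{d}u'\wedge\kappa_T a+\int_T u'\wedge\kappa_T b+\int_T u'\cdot \mathrm{d}v=0,$$ $$\int_T \mathrm{d}u\wedge\kappa_T a'=0,\quad \int_T u\wedge\kappa_T b'=0,\quad \int_T u\cdot \mathrm{d}v'=0,$$ for all $u'\in X^k_0(T)$, $a'\in \mathrm{P}^0\Lambda^{d-k}(T)$, $b'\in \mathrm{P}^0\Lambda^{d-k+1}(T)$, $v'\in Y^{k-1}(T)$. For $T$ a point, $B^0(T)=\mathbb{R}$. $A^k(T)$ is the space of $u\in X^k(T)$ such that $u|_{T'}\in B^k(T')$ for every face $T'$ of $T$ (including $T'=T$). The degrees of freedom on $A^k(T)$ are the integrals on the $k$-dimensional faces of $T$. ''Computed recursively from the degrees of freedom'' means: by a recursion on the dimension of the faces of $T$, starting from the degrees of freedom, where for each face $T'$ of dimension $>k$ the moments of $u|_{T'}$ against constant forms on $T'$ are obtained by explicit linear formulas from the moments of $u$ against constant forms on the codimension one faces of $T'$, the coefficients depending only on $k$ and the geometry of the faces through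 algebraic operations on polynomial forms (and not requiring the solution of the PDEs defining $B^k$). *)

(* Defs.v *)
From HB Require Import structures.
From mathcomp Require Import all_boot all_order all_algebra all_fingroup.
From mathcomp Require Import all_classical all_reals all_analysis.

Set Implicit Arguments.
Unset Strict Implicit.
Unset Printing Implicit Defensive.

Import Order.TTheory GRing.Theory Num.Theory.
Import numFieldNormedType.Exports.

Local Open Scope classical_set_scope.
Local Open Scope ring_scope.

Section LebesgueTuple.
Variable R : realType.

Definition tcons m
    (p : (m.-tuple (measurableTypeR R) * measurableTypeR R)%type) :
  m.+1.-tuple (measurableTypeR R) := [the m.+1.-tuple _ of p.2 :: p.1].

Lemma measurable_tcons m : measurable_fun setT (@tcons m).
Proof. exact: measurable_cons. Qed.

Definition tcons_pushforward m
    (mu : {measure set (m.-tuple (measurableTypeR R)) -> \bar R}) :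
    {measure set (m.+1.-tuple (measurableTypeR R)) -> \bar R} :=
  measure_function_pushforward__canonical__measure_function_Measure
    (mu \x (@lebesgue_measure R))%E (@measurable_tcons m).

(* Lebesgue measure on R^m; on R^0 it is the unit mass at the point. *)
Fixpoint lebesgue_tuple m :
    {measure set (m.-tuple (measurableTypeR R)) -> \bar R} :=
  match m with
  | 0%N => \d_([tuple] : 0.-tuple (measurableTypeR R))
  | m'.+1 => tcons_pushforward (lebesgue_tuple m')
  end.

End LebesgueTuple.

(* A k-covector on R^n is an alternating multilinear function of the k rows of
   a matrix; a k-form assigns one to every point of R^n.  A form on a flat cell
   of R^n is represented by such a form on R^n, of which only the values at
   points of the cell on vectors tangent to the cell are meaningful: every form
   on the cell is represented, by composition with the orthogonal projection.
   With this representation the pullback by the inclusion of a face is the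
   identity on representatives. *)
Section Forms.
Variables (R : realType) (n : nat).

Definition dform (k : nat) := 'rV[R]_n -> 'M[R]_(k, n) -> R.

Definition alternating k (f : 'M[R]_(k, n) -> R) :=
  (forall (i : 'I_k) (A B C : 'M[R]_(k, n)) (b c : R),
     row i A = b *: row i B + c *: row i C ->
     row' i B = row' i A -> row' i C = row' i A ->
     f A = b * f B + c * f C) /\
  (forall (i1 i2 : 'I_k) (A : 'M[R]_(k, n)),
     i1 != i2 -> row i1 A = row i2 A -> f A = 0).

Definition wedge k l (u : dform k) (w : dform l) : dform (k + l) := fun x A =>
  (k`! * l`!)%:R^-1 *
  \sum_(s : 'S_(k + l))
    (-1) ^+ s * u x (usubmx (row_perm s A)) * w x (dsubmx (row_perm s A)).

(* Contraction by the vector field x |-> x - b, zero on 0-forms. *)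
Definition contraction (b : 'rV[R]_n) k : dform k -> dform k.-1 :=
  match k return dform k -> dform k.-1 with
  | 0%N => fun _ _ _ => 0
  | k'.+1 => fun u x A => u x (col_mx (x - b) A : 'M[R]_(1 + k', n))
  end.

Definition ext_deriv k (u : dform k) : dform k.+1 := fun x A =>
  \sum_(i < k.+1) (-1) ^+ i * 'D_(row i A) (fun y => u y (row' i A)) x.

(* Every polynomial form on a cell is the restriction of a polynomial form on
   R^n of the same degree. *)
Definition poly_form s k (u : dform k) :=
  (forall x, alternating (u x)) /\
  (forall A : 'M[R]_(k, n), exists c : {ffun 'I_n -> 'I_s.+1} -> R,
     forall x, u x A =
       \sum_(m : {ffun 'I_n -> 'I_s.+1} | (\sum_i m i <= s)%N)
         c m * \prod_i x 0 i ^+ m i).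

Fixpoint diff_order (r : nat) (f : 'rV[R]_n -> R) : Prop :=
  match r with
  | 0%N => continuous f
  | r'.+1 => continuous f /\
      forall v, (forall x, derivable f x v) /\ diff_order r' ('D_v f)
  end.

Definition smooth_form k (u : dform k) :=
  (forall x, alternating (u x)) /\
  (forall (A : 'M[R]_(k, n)) r, diff_order r (u ^~ A)).

End Forms.

(* A face of the convex hull of the points p i, supported by the linear
   function x |-> x *m c, is encoded by the set of all i such that p i is in
   it; a repeated or non extremal point does no harm. *)
Section Faces.
Variables (R : realType) (n N : nat) (p : 'I_N -> 'rV[R]_n).
Implicit Types I J : {set 'I_N}.

Definition whole : {set 'I_N} := finset.setTfor 'I_N.

Definition hull I : set 'rV[R]_n :=
  [set x | exists c : 'I_N -> R,
     [/\ forall i, 0 <= c i, forall i, i \notin I -> c i = 0,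
         \sum_i c i = 1 & x = \sum_i c i *: p i]].

Definition is_face I :=
  I != finset.set0 /\
  exists (c : 'cV[R]_n) (b : R),
    forall i, (p i *m c) 0 0 <= b /\ (i \in I) = ((p i *m c) 0 0 == b).

Definition directions I : 'M[R]_n :=
  (\sum_(i in I) \sum_(j in I) <<p i - p j>>)%MS.

Definition fdim I : nat := \rank (directions I).

Definition is_facet I J :=
  [/\ is_face I, is_face J, J \subset I & (fdim J).+1 = fdim I].

Definition relint I : set 'rV[R]_n :=
  hull I `\` \bigcup_(J in [set J | is_facet I J]) hull J.

End Faces.

(* An oriented convex polytope of R^n: each face comes with a positively
   oriented orthonormal basis of its tangent space, the rows of [frame]. *)
Record polytope (R : realType) (n N : nat) := Polytope {
  vertex : 'I_N -> 'rV[R]_n;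
  frame : forall I : {set 'I_N}, 'M[R]_(fdim vertex I, n);
  frame_orthonormal :
    forall I, is_face vertex I -> frame I *m (frame I)^T = 1%:M;
  frame_directions :
    forall I, is_face vertex I -> (frame I :=: directions vertex I)%MS;
}.

Section Spaces.
Variables (R : realType) (n N : nat) (T : polytope R n N).
Implicit Types I J : {set 'I_N}.

Local Notation dform := (dform R n).

Definition face I := is_face (vertex T) I.
Definition facet I J := is_facet (vertex T) I J.
Definition cell I : set 'rV[R]_n := hull (vertex T) I.
Definition cell_dim I : nat := fdim (vertex T) I.

(* The isometry from R^(cell_dim I) to the affine span of the face I defined by
   the frame of I, with origin the mean of the points defining I. *)
Definition chart I (y : (cell_dim I).-tuple (measurableTypeR R)) : 'rV[R]_n :=
  #|I|%:R^-1 *: \sum_(i in I) vertex T i +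
  (\row_j (tnth y j : R)) *m frame T I.

Definition chart_dom I : set ((cell_dim I).-tuple (measurableTypeR R)) :=
  [set y | cell I (chart y)].

Definition integral0 I (g : 'rV[R]_n -> R) : R :=
  Rintegral (@lebesgue_tuple R (cell_dim I)) (@chart_dom I)
    (fun y => g (chart y)).

(* The integral of a p-form on a cell of dimension p.  For another dimension
   [conform_mx] returns the zero matrix, so that the integral is zero if
   p > 0; this is used only for p > cell_dim I, where every form is zero. *)
Definition integral_form I p (u : dform p) : R :=
  integral0 I (fun x => u x (conform_mx 0 (frame T I))).

Definition integral_dot I k (u v : dform k) : R :=
  integral0 I (fun x => (k`!)%:R^-1 *
    \sum_(f : {ffun 'I_k -> 'I_(cell_dim I)})
      u x (rowsub f (frame T I)) * v x (rowsub f (frame T I))).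

Definition barycentre I : 'rV[R]_n :=
  (integral0 I (fun=> 1))^-1 *: \row_j integral0 I (fun x => x 0 j).

Definition kappa I k : dform k -> dform k.-1 :=
  @contraction R n (barycentre I) k.

(* The orientation of the facet J relative to that of I, outward normal first:
   barycentre J - barycentre I is transverse to J and points out of I. *)
Definition orientation I J : R :=
  Num.sg (\det (conform_mx (0 : 'M[R]_(cell_dim I))
    (col_mx (barycentre J - barycentre I) (frame T J) *m (frame T I)^T))).

Definition square_integrable I k (u : dform k) :=
  forall A : 'M[R]_(k, n), (A <= frame T I)%MS ->
    measurable_fun (@chart_dom I) (fun y => u (chart y) A) /\
    (@lebesgue_tuple R (cell_dim I)).-integrable (@chart_dom I)
      (fun y => ((u (chart y) A) ^+ 2)%:E).

Definition compact_support I k (w : dform k) :=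
  exists2 K : set 'rV[R]_n, compact K /\ K `<=` relint (vertex T) I &
    forall x, cell I x -> ~ K x -> forall A, w x A = 0.

Definition weak_deriv I k (u : dform k) (du : dform k.+1) :=
  forall l (w : dform l), (k + l).+1 = cell_dim I ->
    smooth_form w -> compact_support I w ->
    integral_form I (wedge du w) =
    (-1) ^+ k.+1 * integral_form I (wedge u (ext_deriv w)).

(* X^k(I): a form together with its exterior derivative, which is determined
   almost everywhere. *)
Record space_X I k := SpaceX {
  xval :> dform k;
  xd : dform k.+1;
  xval_alternating : forall x, alternating (xval x);
  xd_alternating : forall x, alternating (xd x);
  xval_L2 : square_integrable I xval;
  xd_L2 : square_integrable I xd;
  xd_weak : weak_deriv I xval xd;
}.

(* The traces of u on the facets J of I are the forms h J, in the weak sense: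
   the continuous extension to X^k(I) of the pullback of smooth forms, which is
   given by the Stokes formula for the exterior product with smooth forms. *)
Definition has_trace I k (u : space_X I k) (h : {set 'I_N} -> dform k) :=
  forall l (w : dform l), (k + l).+1 = cell_dim I -> smooth_form w ->
    integral_form I (wedge (xd u) w) +
      (-1) ^+ k * integral_form I (wedge u (ext_deriv w)) =
    \sum_(J : {set 'I_N} | `[< facet I J >])
      orientation I J * integral_form J (wedge (h J) w).

Definition space_X0 I k (u : space_X I k) := has_trace u (fun _ _ _ => 0).

Definition constant_form k (u : dform k) := poly_form 0 u.

Definition P1minus I k (u : dform k) :=
  poly_form 1 u /\ poly_form 1 (kappa I u).

Definition space_W I k (w : dform k) :=
  P1minus I w /\ (k = 0%N -> integral0 I (fun x => w x 0) = 0).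

Definition space_Z0 I k (u : space_X I k) :=
  space_X0 u /\
  forall w : dform (cell_dim I - k), space_W I w ->
    integral_form I (wedge u w) = 0.

(* [in_dpred P g]: g is the derivative of an element of P in degree k - 1; the
   forms of degree -1 are zero. *)
Definition in_dpred I (P : forall k, space_X I k -> Prop) k : dform k -> Prop :=
  match k return dform k -> Prop with
  | 0%N => fun g => g = (fun _ _ => 0)
  | k'.+1 => fun g => exists2 v : space_X I k', P k' v & g = xd v
  end.

Definition in_dZ0 I k (g : dform k) := in_dpred (@space_Z0 I) g.

Definition space_Y I k (u : space_X I k) :=
  space_Z0 u /\ forall g : dform k, in_dZ0 I g -> integral_dot I u g = 0.

Definition in_dY I k (g : dform k) := in_dpred (@space_Y I) g.

Definition space_B I k (u : space_X I k) :=
  (0 < cell_dim I)%N ->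
  (exists (a : dform (cell_dim I - k)) (b : dform ((cell_dim I).+1 - k))
     (dv : dform k),
     [/\ constant_form a, constant_form b, in_dY I dv &
       forall u' : space_X I k, space_X0 u' ->
         integral_dot I (xd u) (xd u') +
         integral_form I (wedge (xd u') (kappa I a)) +
         integral_form I (wedge u' (kappa I b)) +
         integral_dot I u' dv = 0]) /\
  [/\ forall a' : dform (cell_dim I - k), constant_form a' ->
        integral_form I (wedge (xd u) (kappa I a')) = 0,
      forall b' : dform ((cell_dim I).+1 - k), constant_form b' ->
        integral_form I (wedge u (kappa I b')) = 0
    & forall dv' : dform k, in_dY I dv' -> integral_dot I u dv' = 0].

(* The cell itself is the face [whole N].  The trace on a face of codimension
   greater than one is the iterated trace through facets, and it has to be the
   same along every chain of faces. *)
Definition traces k (u : space_X (whole N) k) (tr : forall I, space_X I k) :=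
  tr (whole N) = u /\ forall I, face I -> has_trace (tr I) (fun J => tr J).

(* u belongs to A^k(T), and tr is the family of its traces on the faces. *)
Definition space_A k (u : space_X (whole N) k) (tr : forall I, space_X I k) :=
  traces u tr /\ forall I, face I -> space_B (tr I).

End Spaces.

(* Algebraic operations turning a p-form on a cell into a q-form on one of its
   facets.  They are uniform in the cell and, being built from linear
   operations, they are linear. *)
Inductive form_op : nat -> nat -> Type :=
| OpId p : form_op p p
| OpComp p q r of form_op q r & form_op p q : form_op p r
| OpAdd p q of form_op p q & form_op p q : form_op p q
| OpScale p q of rat & form_op p q : form_op p q
| OpOrientation p q of form_op p q : form_op p q
| OpDeriv p : form_op p p.+1
| OpKappaCell p : form_op p.+1 p
| OpKappaFacet p : form_op p.+1 p.

Section Recursion.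
Variables (R : realType) (n N : nat) (T : polytope R n N).

Fixpoint apply_op (I J : {set 'I_N}) p q (e : form_op p q) :
    dform R n p -> dform R n q :=
  match e in form_op p q return dform R n p -> dform R n q with
  | OpId _ => fun u => u
  | OpComp _ _ _ e1 e2 => fun u => apply_op I J e1 (apply_op I J e2 u)
  | OpAdd _ _ e1 e2 =>
      fun u x A => apply_op I J e1 u x A + apply_op I J e2 u x A
  | OpScale _ _ c e1 => fun u x A => ratr c * apply_op I J e1 u x A
  | OpOrientation _ _ e1 =>
      fun u x A => orientation T I J * apply_op I J e1 u x A
  | OpDeriv _ => fun u => ext_deriv u
  | OpKappaCell _ => fun u => kappa T I u
  | OpKappaFacet _ => fun u => kappa T J u
  end.

(* The moment against the constant l-form a, on the face I of dimension k + l,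
   computed from the values [dof] on the k-dimensional faces. *)
Fixpoint recursive_moment (rule : forall l, form_op l.+1 l)
    (dof : {set 'I_N} -> R) (l : nat) (I : {set 'I_N}) :
    dform R n l -> R :=
  match l return dform R n l -> R with
  | 0%N => fun a => dof I * a (barycentre T I) 0
  | l'.+1 => fun a =>
      \sum_(J : {set 'I_N} | `[< facet T I J >])
        recursive_moment rule dof J (apply_op I J (rule l') a)
  end.

End Recursion.

(* Main.v *)
From mathcomp Require Import all_boot all_order all_algebra all_fingroup.
From mathcomp Require Import all_classical all_reals all_analysis.
From mathcomp Require Import measurable_realfun ring lra.
Require Import Defs.

Set Implicit Arguments.
Unset Strict Implicit.
Unset Printing Implicit Defensive.

Import Order.TTheory GRing.Theory Num.Theory.
Import numFieldNormedType.Exports.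

Local Open Scope ring_scope.

(** The recursion is Stokes' formula on a face [I] of dimension [k + l + 1],
    tested with the Koszul contraction [kappa T I a] of a constant form [a] of
    degree [l + 1].  Since [a] is constant, the exterior derivative of this
    contraction is [(l + 1) a] (Cartan's homotopy formula,
    [ext_deriv_contraction]), so that the formula reads
<<
      int_I du /\ kappa_I a + (-1)^k (l + 1) int_I u /\ a
        = sum_J or(I, J) int_J u /\ kappa_I a,
>>
    the sum being over the facets [J] of [I].  The first orthogonality in the
    definition of [B^k(I)] says that the first integral is zero.  On a facet,
    [kappa_I a] differs from [kappa_J a] by the contraction of [a] with the
    constant vector [b_J - b_I], which is a constant form
    ([constant_contractionB]), and the second orthogonality, in [B^k(J)], says
    that [kappa_J a] contributes nothing ([integral_kappa_facet]; when [J] is a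
    point, [kappa_J a] is zero there).  Hence
<<
      int_I u /\ a
        = (-1)^k / (l + 1) sum_J or(I, J) int_J u /\ (kappa_I - kappa_J) a,
>>
    which is [moment_facets]; its right hand side only involves moments against
    constant forms on the facets, so that induction on [l] goes down to the
    integrals over the [k]-dimensional faces.

    Splitting and scaling the integrals requires the integrands to be
    integrable.  A cell is compact, hence its domain in the chart is measurable
    and of finite Lebesgue measure, forms with square integrable coefficients
    are integrable, and so are their products with forms with continuous
    coefficients ([integrable_wedge]). *)

(** * Alternating functions of the rows of a matrix *)
Section Alternating.
Variables (R : realType) (n : nat).

(** A permutation is a product of transpositions, and a transposition changes
    the sign: expand the value at a matrix whose two rows are both the sum of
    the rows to be exchanged. *)
Lemma alternating_perm k (f : 'M[R]_(k, n) -> R) (s : 'S_k) A :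
  alternating f -> f (row_perm s A) = (-1) ^+ s * f A.
Proof.
move=> [flin falt].
have ftperm (i1 i2 : 'I_k) B : i1 != i2 -> f (row_perm (tperm i1 i2) B) = - f B.
  move=> i12.
  (* [M u v] is [B] with its rows [i1] and [i2] replaced by [u] and [v]. *)
  pose M (u v : 'rV[R]_n) := \matrix_(i, j)
    if i == i1 then u 0 j else if i == i2 then v 0 j else B i j.
  have row1 u v : row i1 (M u v) = u by apply/rowP => j; rewrite !mxE eqxx.
  have row2 u v : row i2 (M u v) = v.
    by apply/rowP => j; rewrite !mxE eq_sym (negPf i12) eqxx.
  have MDl u u' v : f (M (u + u') v) = f (M u v) + f (M u' v).
    rewrite (flin i1 _ (M u v) (M u' v) 1 1) ?mul1r ?row1 ?scale1r //.
      by apply/matrixP => i j; rewrite !mxE eq_sym (negPf (neq_lift _ _)).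
    by apply/matrixP => i j; rewrite !mxE eq_sym (negPf (neq_lift _ _)).
  have MDr u v v' : f (M u (v + v')) = f (M u v) + f (M u v').
    rewrite (flin i2 _ (M u v) (M u v') 1 1) ?mul1r ?row2 ?scale1r //.
      apply/matrixP => i j; rewrite !mxE [lift _ _ == i2]eq_sym.
      by rewrite (negPf (neq_lift _ _)).
    apply/matrixP => i j; rewrite !mxE [lift _ _ == i2]eq_sym.
    by rewrite (negPf (neq_lift _ _)).
  have M0 u : f (M u u) = 0 by apply: (falt i1 i2) => //; rewrite row1 row2.
  have := M0 (row i1 B + row i2 B).
  rewrite MDl !MDr !M0 add0r addr0 => /eqP; rewrite addrC addr_eq0 => /eqP.
  have -> : M (row i1 B) (row i2 B) = B.
    apply/matrixP => i j; rewrite !mxE; case: eqP => [->//|_].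
    by case: eqP => [->|].
  suff -> : M (row i2 B) (row i1 B) = row_perm (tperm i1 i2) B by [].
  apply/matrixP => i j; rewrite !mxE.
  by case: tpermP => [->|->|/eqP/negPf-> /eqP/negPf->//];
    rewrite ?eqxx // eq_sym (negPf i12).
have [ts -> dts] := prod_tpermP s; rewrite /= in dts *.
elim: ts dts A => [_|[i1 i2] ts IHts /andP[/= i12 dts]] A.
  by rewrite big_nil odd_perm1 row_perm1 mul1r.
rewrite big_cons row_permM ftperm // IHts // odd_permM odd_tperm i12.
by rewrite signr_addb expr1 mulN1r mulNr.
Qed.

Variables (k : nat) (f : 'M[R]_(1 + k, n) -> R).
Hypothesis falt : alternating f.

Lemma alternating_col_mx_linear A (b c : R) u v :
  f (col_mx (b *: u + c *: v) A) = b * f (col_mx u A) + c * f (col_mx v A).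
Proof.
have row1 w : row (0 : 'I_(1 + k)) (col_mx w A) = w.
  by apply/rowP => j; rewrite !mxE; case: splitP => // i _; rewrite ord1.
have row'1 w : row' (0 : 'I_(1 + k)) (col_mx w A) = A.
  apply/matrixP => i j; rewrite mxE (_ : lift 0 i = rshift 1 i) ?col_mxEd //.
  exact: val_inj.
by apply: (falt.1 0); rewrite ?row1 ?row'1.
Qed.

Lemma alternating_col_mx v :
  alternating (fun A : 'M[R]_(k, n) => f (col_mx v A)).
Proof.
have rowS (i : 'I_k) A : row (rshift 1 i) (col_mx v A) = row i A.
  by rewrite rowKd.
have row'S (i : 'I_k) A B : row' i A = row' i B ->
    row' (rshift 1 i) (col_mx v A) = row' (rshift 1 i) (col_mx v B).
  move=> eqAB; apply/matrixP => a j; rewrite !mxE.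
  case: splitP => // b eb.
  have [c ->] : exists c, b = lift i c.
    case: (unliftP i b) => [c ->|bi]; first by exists c.
    have := neq_lift (rshift 1 i) a.
    by rewrite -val_eqE /= in eb *; rewrite eb bi eqxx.
  by have /matrixP/(_ c j) := eqAB; rewrite !mxE.
split=> [i A B C b c rA rB rC|i1 i2 A i12 eqA].
  by apply: (falt.1 (rshift 1 i)); rewrite ?rowS //; apply: row'S.
apply: (falt.2 (rshift 1 i1) (rshift 1 i2)); rewrite ?rowS //.
Qed.

(** Moving row [i] to the front is the cycle [lift_perm 0 i 1], whose parity is
    that of [i]. *)
Lemma alternating_cycle (i : 'I_(1 + k)) A :
  f (col_mx (row i A) (row' i A)) = (-1) ^+ i * f A.
Proof.
have -> : col_mx (row i A) (row' i A) =
    row_perm (lift_perm (0 : 'I_k.+1) i 1) A.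
  apply/matrixP => a j; rewrite !mxE; case: splitP => b ab; rewrite !mxE.
    have -> : a = 0 :> 'I_k.+1 by apply/val_inj; rewrite ord1 in ab.
    by rewrite lift_perm_id.
  have -> : a = lift (0 : 'I_k.+1) b by apply/val_inj.
  by rewrite lift_perm_lift perm1.
rewrite alternating_perm // odd_lift_perm odd_perm1 /= addbF.
by rewrite signr_odd.
Qed.

End Alternating.

(** * Contraction of constant forms by a radial vector field *)
Section AffineFunctions.
Local Open Scope classical_set_scope.
Variables (R : realType) (n : nat) (L : 'rV[R]_n -> R).
Hypothesis L_linear :
  forall (b c : R) u v, L (b *: u + c *: v) = b * L u + c * L v.

Let L0 : L 0 = 0.
Proof. by have := L_linear 0 0 0 0; rewrite !scale0r addr0 !mul0r addr0. Qed.

Let LD u v : L (u + v) = L u + L v.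
Proof. by have := L_linear 1 1 u v; rewrite !scale1r !mul1r. Qed.

Let LZ b u : L (b *: u) = b * L u.
Proof. by have := L_linear b 0 u 0; rewrite scaler0 addr0 mul0r addr0. Qed.

Let LN u : L (- u) = - L u.
Proof. by rewrite -scaleN1r LZ mulN1r. Qed.

Lemma affine_is_derive b x v :
  is_derive x v (fun y : 'rV[R]_n => L (y - b)) (L v).
Proof.
have cvgL :
    h^-1 *: (((fun y : 'rV[R]_n => L (y - b)) \o shift x) (h *: v) -
             L (x - b)) @[h --> 0^'] --> L v.
  apply: cvg_near_cst; near=> h.
  have h0 : h != 0 by near: h; exact: nbhs_dnbhs_neq.
  rewrite /= -[X in L X - _]addrA LD addrK LZ.
  by rewrite -[LHS]/(h^-1 * (h * L v)) mulKf.
by split; [apply/cvg_ex; exists (L v)|exact: cvg_lim].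
Unshelve. all: by end_near. Qed.

Lemma affine_continuous b : continuous (fun y : 'rV[R]_n => L (y - b)).
Proof.
have -> : (fun y : 'rV[R]_n => L (y - b)) =
    (fun y : 'rV[R]_n => \sum_j y 0 j * L (delta_mx 0 j) - L b).
  apply/funext => y; rewrite LD LN; congr (_ - _).
  rewrite [in LHS](row_sum_delta y) (big_morph L LD L0).
  by apply: eq_bigr => j _; rewrite LZ.
have sum_cts : continuous (fun y : 'rV[R]_n => \sum_j y 0 j * L (delta_mx 0 j)).
  apply: continuous_big => [|j _]; first exact: add_continuous.
  move=> x; apply: continuousM; first exact: coord_continuous.
  exact: cst_continuous.
move=> x; apply: continuousB; first exact: sum_cts.
exact: cst_continuous.
Qed.

Lemma diff_order_cst r (c : R) : diff_order r (fun _ : 'rV[R]_n => c).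
Proof.
elim: r c => [|r IHr] c; first exact: cst_continuous.
split=> [|v]; first exact: cst_continuous.
split=> [x|]; first exact: derivable_cst.
have -> : 'D_v (fun _ : 'rV[R]_n => c) = (fun=> 0).
  by apply/funext => x; exact: derive_cst.
exact: IHr.
Qed.

Lemma diff_order_affine r b : diff_order r (fun y : 'rV[R]_n => L (y - b)).
Proof.
case: r => [|r]; first exact: affine_continuous.
split=> [|v]; first exact: affine_continuous.
split=> [x|]; first by have [] := affine_is_derive b x v.
have -> : 'D_v (fun y : 'rV[R]_n => L (y - b)) = (fun=> L v).
  by apply/funext => x; have [] := affine_is_derive b x v.
exact: diff_order_cst.
Qed.

End AffineFunctions.

Section ConstantForms.
Variables (R : realType) (n : nat).

(** Polynomials of degree at most 0 are indexed by functions from ['I_n] to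
    ['I_1], of which there is only one. *)
Lemma constant_formP k (a : dform R n k) :
  constant_form a <->
  (forall x, alternating (a x)) /\ (forall x, a x = a 0).
Proof.
have m_eq (m m' : {ffun 'I_n -> 'I_1}) : m = m'.
  by apply/ffunP => i; rewrite !ord1.
split=> [[aalt apoly]|[aalt acst]]; split=> //.
  move=> x; apply/funext => A; have [c ca] := apoly A.
  rewrite !ca; apply: eq_bigr => m _; congr (_ * _).
  by apply: eq_bigr => i _; rewrite ord1 !expr0.
move=> A; exists (fun=> a 0 A) => x; rewrite acst.
pose m0 : {ffun 'I_n -> 'I_1} := [ffun=> 0].
rewrite (bigD1 m0) /=; last by rewrite big1 // => i _; rewrite ffunE.
rewrite big1 ?mulr1 => [|i _]; last by rewrite ffunE expr0.
by rewrite big1 ?addr0 // => m /andP[_]; rewrite (m_eq m m0) eqxx.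
Qed.

Variables (l : nat) (a : dform R n l.+1).
Hypothesis a_cst : constant_form a.

Let a_alt x : alternating (a x) := ((constant_formP a).1 a_cst).1 x.
Let aE x : a x = a 0 := ((constant_formP a).1 a_cst).2 x.

Lemma contraction_constantE b :
  contraction b a = fun x A => a 0 (col_mx (x - b) A : 'M[R]_(1 + l, n)).
Proof. by apply/funext => x; apply/funext => A; rewrite /= aE. Qed.

Lemma smooth_contraction b : smooth_form (contraction b a).
Proof.
rewrite contraction_constantE; split=> [x|A r].
  exact/(@alternating_col_mx _ _ l)/a_alt.
apply: (diff_order_affine (L := fun v => a 0 (col_mx v A : 'M[R]_(1 + l, n)))).
by move=> *; exact/(@alternating_col_mx_linear _ _ l)/a_alt.
Qed.

(** Differentiating [x - b] along row [i] of [A] puts this row in front of the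
    others; moving it back to its place gives the sign [(-1) ^+ i], which
    cancels the one in the exterior derivative.  Each of the [l.+1] terms is
    thus [a x A]. *)
Lemma ext_deriv_contraction b :
  ext_deriv (contraction b a) = fun x A => l.+1%:R * a x A.
Proof.
apply/funext => x; apply/funext => A; rewrite /ext_deriv contraction_constantE.
transitivity (\sum_(i < l.+1) a 0 A); last first.
  by rewrite sumr_const card_ord aE mulr_natl.
apply: eq_bigr => i _.
rewrite (_ : 'D_ _ _ _ = a 0 (col_mx (row i A) (row' i A) : 'M[R]_(1 + l, n))).
  by rewrite alternating_cycle // mulrA -signr_odd -expr2 sqrr_sign mul1r.
pose L v := a 0 (col_mx v (row' i A) : 'M[R]_(1 + l, n)).
have [|_ ->//] := @affine_is_derive _ _ L _ b x (row i A).
by move=> *; exact/(@alternating_col_mx_linear _ _ l)/a_alt.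
Qed.

(** The point [x] cancels in the difference of the two vector fields. *)
Lemma constant_contractionB (c : R) b1 b2 :
  constant_form (fun x A => c * (contraction b1 a x A - contraction b2 a x A)).
Proof.
have E x A : contraction b1 a x A - contraction b2 a x A =
    a 0 (col_mx (b2 - b1) A : 'M[R]_(1 + l, n)).
  rewrite !contraction_constantE.
  have -> : b2 - b1 = 1 *: (x - b1) + (-1) *: (x - b2).
    by rewrite scale1r scaleN1r opprB [RHS]addrC addrA subrK.
  by rewrite (@alternating_col_mx_linear _ _ l _ (a_alt 0)) mul1r mulN1r.
apply/constant_formP; split=> x; last first.
  by apply/funext => A; rewrite !E.
have [alin aalt] := @alternating_col_mx _ _ l _ (a_alt 0) (b2 - b1).
split=> [i A B C b d rA rB rC|i j A ij rA]; rewrite !E.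
  by rewrite (alin i A B C b d) //; ring.
by rewrite (aalt i j A) ?mulr0.
Qed.

End ConstantForms.

(** * Measurability of closed sets and finite measure of boxes *)
Section ContinuousMeasurable.
Local Open Scope classical_set_scope.
Context (d : measure_display) (E : measurableType d) (R : realType) (n : nat).
Variable f : E -> 'rV[R]_n.
Hypothesis f_coord : forall j, measurable_fun setT (fun y => f y 0 j).

(** An open set is the union of the boxes with rational centre and radius
    [1 / m] that it contains, and these are countably many. *)
Lemma measurable_preimage_open (U : set 'rV[R]_n) :
  open U -> measurable (f @^-1` U).
Proof.
move=> Uop.
pose box (qm : 'rV[rat]_n * nat) : set 'rV[R]_n :=
  [set x | forall j, `|x 0 j - ratr (qm.1 0 j)| < qm.2.+1%:R^-1].
pose F qm := if `[< box qm `<=` U >] then f @^-1` box qm else set0.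
have -> : f @^-1` U = \bigcup_qm F qm.
  apply/seteqP; split=> [y /= Uy|y [qm _]]; last first.
    by rewrite /F; case: asboolP => // + fy; apply.
  have /nbhs_ballP[e /= e0 ballU] := open_nbhs_nbhs (conj Uop Uy).
  have [m me] : exists m : nat, m.+1%:R^-1 < e / 2.
    have e20 : 0 < e / 2 by rewrite divr_gt0.
    have [m _ me] := near_infty_natSinv_lt (PosNum e20).
    by exists m; exact: (me m (leqnn m)).
  have q_ex j : exists q : rat, `|f y 0 j - ratr q| < m.+1%:R^-1.
    have [|q] := @rat_in_itvoo R (f y 0 j - m.+1%:R^-1) (f y 0 j + m.+1%:R^-1).
      by rewrite ltrD2l gtrN // invr_gt0.
    by rewrite in_itv /= => ?; exists q; rewrite distrC ltr_distl.
  have [q qP] := choice q_ex.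
  exists (\row_j q j, m) => //; rewrite /F; case: asboolP => [_|[]] /=.
    by move=> j; rewrite mxE.
  move=> x xbox; apply: ballU; split=> // i j; rewrite ord1.
  have := xbox j; rewrite /= mxE => xq.
  rewrite /ball /= (splitr e) (le_lt_trans (ler_distD (ratr (q j)) _ _)) //.
  by rewrite ltrD ?(lt_trans (qP j)) // distrC (lt_trans xq).
apply: countable_bigcupT_measurable => // qm; rewrite /F.
case: asboolP => // _.
have -> : f @^-1` box qm =
    \bigcap_(j in [set: 'I_n]) ((fun y => f y 0 j) @^-1`
      ball (ratr (qm.1 0 j) : R) qm.2.+1%:R^-1).
  apply/seteqP; split=> y /= yP j.
    by move=> _; rewrite /= /ball /= distrC.
  by have := yP j I; rewrite /= /ball /= distrC.
apply: fin_bigcap_measurable => // j _.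
rewrite -[X in measurable X]setTI; apply: f_coord => //.
exact: measurable_ball.
Qed.

Lemma measurable_preimage_closed (U : set 'rV[R]_n) :
  closed U -> measurable (f @^-1` U).
Proof.
move=> Ucl; rewrite -[X in measurable X]setCK preimage_setC.
by apply: measurableC; apply: measurable_preimage_open; exact: closed_openC.
Qed.

(** The Borel sets of [R] are generated by the open intervals. *)
Lemma measurable_continuous_comp (g : 'rV[R]_n -> R) :
  continuous g -> measurable_fun setT (g \o f).
Proof.
move=> /continuousP g_cts.
apply: (measurability _ (RGenOpens.measurableE R)) => _ [_ [a [b ->] <-]].
rewrite setTI comp_preimage; apply: measurable_preimage_open.
by apply: g_cts; exact: interval_open.
Qed.

End ContinuousMeasurable.

Section LebesgueBox.
Local Open Scope classical_set_scope.
Variable R : realType.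

Definition tuple_box m (M : R) : set (m.-tuple (measurableTypeR R)) :=
  [set y | forall i, `|tnth y i : R| <= M].

Lemma measurable_tuple_box m M : measurable (@tuple_box m M).
Proof.
have -> : @tuple_box m M =
    \bigcap_(i in [set: 'I_m]) ((fun y => tnth y i) @^-1` `[- M, M]).
  apply/seteqP; split=> y /= yP i.
    by move=> _; rewrite /= in_itv /= -ler_norml.
  by have := yP i I; rewrite /= in_itv /= -ler_norml.
apply: fin_bigcap_measurable => // i _.
by rewrite -[X in measurable X]setTI; apply: measurable_tnth.
Qed.

(** By Fubini, the measure of a box is the product of the lengths of its
    sides. *)
Lemma lebesgue_tuple_box_fin m M : (lebesgue_tuple R m (tuple_box M) < +oo)%E.
Proof.
elim: m => [|m IHm] /=.
  by rewrite /dirac indicE; case: (_ \in _); rewrite ltry.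
rewrite /pushforward.
have -> : (@tcons R m) @^-1` (tuple_box M) = tuple_box M `*` `[- M, M].
  apply/seteqP; split=> -[y t] /=.
    move=> yP; split=> [i|]; last by have := yP 0; rewrite in_itv /= -ler_norml.
    by have := yP (lift 0 i); rewrite tnthS.
  rewrite in_itv /= -ler_norml => -[yP tP] i.
  by case: (unliftP 0 i) => [j ->|->]; rewrite ?tnthS ?tnth0.
rewrite product_measure1E //; last exact: measurable_tuple_box.
rewrite lte_mul_pinfty //.
  by rewrite ge0_fin_numE.
have /= := lebesgue_measure_itv (Interval (BLeft (- M)) (BRight M)).
by move=> ->; case: ifP; rewrite ?ltry.
Qed.

End LebesgueBox.

(** * Cells are compact and have finite measure *)
Section Hull.
Local Open Scope classical_set_scope.
Variables (R : realType) (n N : nat) (p : 'I_N -> 'rV[R]_n).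

(** The hull is the continuous image of a face of the standard simplex, which is
    the intersection of a product of compact intervals with a hyperplane. *)
Lemma compact_hull I : compact (hull p I).
Proof.
pose simplex : set 'rV[R]_N :=
  [set c | forall i, (if i \in I then `[0, 1] else [set 0]) (c 0 i)] `&`
  [set c | \sum_i c 0 i = 1].
have simplex_compact : compact simplex.
  apply: compact_closedI.
    apply: (@rV_compact R N
      (fun i => if i \in I then `[0, 1] else [set 0])) => i.
    case: ifP => _; last exact: compact_set1.
    exact: segment_compact.
  apply: (closed_comp (f := fun c : 'rV[R]_N => \sum_i c 0 i) (D := [set 1])).
    move=> c _; move: c; apply: continuous_big => [|i _].
      exact: add_continuous.
    exact: coord_continuous.
  exact: closed_eq.
have -> : hull p I = (fun c : 'rV[R]_N => \sum_i c 0 i *: p i) @` simplex.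
  apply/seteqP; split=> x /=.
    move=> [c [c0 cI c1 ->]]; exists (\row_i c i); last first.
      by apply: eq_bigr => i _; rewrite mxE.
    split=> [i|] /=; last first.
      by rewrite -[RHS]c1; apply: eq_bigr => i _; rewrite mxE.
    rewrite mxE; case: ifPn => [_|/cI //].
    rewrite /= in_itv /= c0 -c1 (bigD1 i) //= lerDl.
    by apply: sumr_ge0 => j _; exact: c0.
  move=> [c [cP c1] <-]; exists (c 0); split=> // i.
    by have := cP i; case: ifP => _ /=; [rewrite in_itv => /andP[]|move->].
  by move=> /negPf iI; have := cP i; rewrite iI.
apply: continuous_compact simplex_compact.
apply: continuous_subspaceT; apply: continuous_big => [|i _].
  exact: add_continuous.
move=> c; apply: (@continuous_comp _ _ _ (fun c : 'rV[R]_N => c 0 i : R^o)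
  (fun b => b *: p i)); first exact: coord_continuous.
exact: scalel_continuous.
Qed.

End Hull.

Section Cells.
Local Open Scope classical_set_scope.
Variables (R : realType) (n N : nat) (T : polytope R n N).
Implicit Types I J : {set 'I_N}.

Lemma chart_coord_measurable I j :
  measurable_fun setT (fun y => @chart R n N T I y 0 j).
Proof.
have -> : (fun y => @chart R n N T I y 0 j) = fun y =>
    (#|I|%:R^-1 *: \sum_(i in I) vertex T i) 0 j +
    \sum_i (tnth y i : R) * frame T I i j.
  apply/funext => y; rewrite /chart mxE [X in _ + X]mxE; congr (_ + _).
  by apply: eq_bigr => i _; rewrite mxE.
apply: measurable_funD => //; apply: measurable_sum => i.
by apply: measurable_funM => //; exact: measurable_tnth.
Qed.

Lemma measurable_chart_dom I : measurable (@chart_dom R n N T I).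
Proof.
apply: (measurable_preimage_closed (@chart_coord_measurable I)).
apply: compact_closed; first exact: norm_hausdorff.
exact: compact_hull.
Qed.

Lemma bounded_on_cell I (g : 'rV[R]_n -> R) : continuous g ->
  exists M, forall y, @chart_dom R n N T I y -> `|g (@chart R n N T I y)| <= M.
Proof.
move=> g_cts.
have /compact_bounded[M [_ MP]] : compact (g @` cell T I).
  apply: continuous_compact; last exact: compact_hull.
  exact: continuous_subspaceT.
exists (M + 1) => y yP; apply: MP; first by rewrite ltrDl.
by exists (chart y).
Qed.

(** The rows of the frame are orthonormal, so that its transpose is an inverse
    of the chart: the coordinates [y] are continuous functions of the point,
    hence bounded on the cell. *)
Lemma chart_dom_fin I : face T I ->
  (lebesgue_tuple R (cell_dim T I) (@chart_dom R n N T I) < +oo)%E.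
Proof.
move=> /(frame_orthonormal (p := T)) FF.
pose o := #|I|%:R^-1 *: \sum_(i in I) vertex T i.
pose g i (x : 'rV[R]_n) := ((x - o) *m (frame T I)^T) 0 i.
have gE i y : g i (@chart R n N T I y) = tnth y i.
  by rewrite /g /chart addrC addKr -mulmxA FF mulmx1 mxE.
have g_cts i : continuous (g i).
  apply: (affine_continuous (L := fun x => (x *m (frame T I)^T) 0 i)).
  by move=> b c u v; rewrite mulmxDl -!scalemxAl !mxE.
have [M MP] : exists M, @chart_dom R n N T I `<=` tuple_box M.
  have [M MP] := choice (fun i => @bounded_on_cell I _ (g_cts i)).
  exists (\sum_i `|M i|) => y yP i; rewrite -gE.
  rewrite (le_trans (MP i y yP)) // (le_trans (ler_norm _)) //.
  by rewrite (bigD1 i) //= lerDl sumr_ge0.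
apply: le_lt_trans (lebesgue_tuple_box_fin _ M).
apply: le_measure => //; rewrite inE; first exact: measurable_chart_dom.
exact: measurable_tuple_box.
Qed.

End Cells.

(** * Linearity of the integral of an exterior product *)
Section Wedge.
Variables (R : realType) (n : nat).

Lemma wedgeDr k l (u : dform R n k) (w1 w2 : dform R n l) x A :
  wedge u (fun x A => w1 x A + w2 x A) x A = wedge u w1 x A + wedge u w2 x A.
Proof.
rewrite /wedge -mulrDr -big_split; congr (_ * _).
by apply: eq_bigr => s _; rewrite mulrDr.
Qed.

Lemma wedgeZr k l (u : dform R n k) (w : dform R n l) c x A :
  wedge u (fun x A => c * w x A) x A = c * wedge u w x A.
Proof.
rewrite /wedge mulrCA; congr (_ * _); rewrite big_distrr.
by apply: eq_bigr => s _; rewrite mulrCA.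
Qed.

Lemma usubmx0_castmx k (A : 'M[R]_(k + 0, n)) :
  usubmx A = castmx (addn0 k, erefl n) A.
Proof.
by apply/matrixP => i j; rewrite castmxE mxE; congr (A _ _); apply/val_inj.
Qed.

Lemma castmx_conform0 m p q (e : p = q) (F : 'M[R]_(m, n)) :
  castmx (e, erefl n) (conform_mx 0 F) = conform_mx 0 F.
Proof. by case: q / e; rewrite castmx_id. Qed.

Lemma conform0_sub m p (F : 'M[R]_(m, n)) :
  ((conform_mx 0 F : 'M[R]_(p, n)) <= F)%MS.
Proof.
have [e|mp] := eqVneq m p; last by rewrite nonconform_mx ?mp // sub0mx.
by case: p / e; rewrite conform_mx_id submx_refl.
Qed.

Lemma alternating_castmx k q (e : q = k) (f : 'M[R]_(k, n) -> R) :
  alternating f -> alternating (fun A => f (castmx (e, erefl n) A)).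
Proof. by case: k / e f.
Qed.

(** All the permutations give the same term, and their number is the factorial
    by which the sum is divided. *)
Lemma wedge_form0 k (u : dform R n k) (a : dform R n 0) x A :
  alternating (u x) -> wedge u a x A = u x (usubmx A) * a x 0.
Proof.
move=> /(alternating_castmx (addn0 k)) ualt; rewrite /wedge.
transitivity ((k`! * 0`!)%:R^-1 * \sum_(s : 'S_(k + 0)) u x (usubmx A) * a x 0).
  congr (_ * _); apply: eq_bigr => s _.
  rewrite (flatmx0 (dsubmx _)) !usubmx0_castmx (alternating_perm s A ualt).
  by rewrite mulrA -expr2 sqrr_sign mul1r.
by rewrite sumr_const card_Sn addn0 fact0 muln1 -[X in _ * X]mulr_natl mulKf //.
Qed.

End Wedge.

Section Integrability.
Local Open Scope classical_set_scope.
Variables (R : realType) (n N : nat) (T : polytope R n N) (I : {set 'I_N}).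
Hypothesis faceI : face T I.

Notation mu := (lebesgue_tuple R (cell_dim T I)).
Notation D := (@chart_dom R n N T I).
Notation ch := (@chart R n N T I).

Let mD : measurable D := @measurable_chart_dom R n N T I.

(** On a domain of finite measure [L^2] is contained in [L^1], because
    [`|t| <= 1 + t ^+ 2]. *)
Lemma square_integrable_integrable k (u : dform R n k) A :
  square_integrable T I u -> (A <= frame T I)%MS ->
  mu.-integrable D (EFin \o (fun y => u (ch y) A)).
Proof.
move=> uL2 /uL2[u_meas u2_int].
have one_int : mu.-integrable D (EFin \o (fun=> 1)).
  apply: measurable_bounded_integrable => //; first exact: chart_dom_fin.
  exact: bounded_cst.
apply: (le_integrable mD _ _ (integrableD mD one_int u2_int)).
  exact/measurable_EFinP.
move=> y _; rewrite /= lee_fin [leRHS]ger0_norm ?addr_ge0 ?sqr_ge0 //.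
rewrite -[X in 1 + X]real_normK ?num_real //.
have := sqr_ge0 (`|u (ch y) A| - 1); have := normr_ge0 (u (ch y) A).
by move: `|_| => t; nra.
Qed.

Lemma integrable_wedge k l (u : dform R n k) (w : dform R n l) :
  square_integrable T I u -> (forall A, continuous (w ^~ A)) ->
  mu.-integrable D
    (EFin \o (fun y => wedge u w (ch y) (conform_mx 0 (frame T I)))).
Proof.
move=> uL2 w_cts; set F := conform_mx 0 _.
have term_int (s : 'S_(k + l)) : mu.-integrable D (EFin \o (fun y =>
    (-1) ^+ s * u (ch y) (usubmx (row_perm s F)) *
    w (ch y) (dsubmx (row_perm s F)))).
  have A_sub : (usubmx (row_perm s F) <= frame T I)%MS.
    apply: submx_trans (conform0_sub (k + l) _); rewrite -/F.
    have -> : usubmx (row_perm s F) = rowsub (s \o lshift l) F.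
      by apply/matrixP => i j; rewrite !mxE.
    by apply/row_subP => i; rewrite row_rowsub row_sub.
  have u_int := square_integrable_integrable uL2 A_sub.
  have [M MP] := @bounded_on_cell R n N T I _ (w_cts (dsubmx (row_perm s F))).
  have w_meas : measurable_fun D (fun y => w (ch y) (dsubmx (row_perm s F))).
    have := measurable_continuous_comp (@chart_coord_measurable _ _ _ T I)
      (w_cts (dsubmx (row_perm s F))).
    exact: measurable_funTS.
  apply: (integrableMl mD (integrableZl mD ((-1) ^+ s) u_int) w_meas).
  exists M; split; first exact: num_real.
  by move=> M' /ltW MM' y /= yD; exact: le_trans (MP y yD) MM'.
have := integrableZl mD (k`! * l`!)%:R^-1
  (integrable_sum mD (index_enum 'S_(k + l)) (P := xpredT)
     (fun s _ => term_int s)).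
by congr (integrable _ _ _); apply/funext => y /=; rewrite sumEFin.
Qed.

Lemma integral_wedgeDr k l (u : dform R n k) (w1 w2 : dform R n l) :
  square_integrable T I u -> (forall A, continuous (w1 ^~ A)) ->
  (forall A, continuous (w2 ^~ A)) ->
  integral_form T I (wedge u (fun x A => w1 x A + w2 x A)) =
  integral_form T I (wedge u w1) + integral_form T I (wedge u w2).
Proof.
move=> uL2 w1_cts w2_cts; rewrite /integral_form /integral0.
rewrite -(RintegralD mD) ?integrable_wedge //.
by apply: eq_Rintegral => y _; rewrite wedgeDr.
Qed.

Lemma integral_wedgeZr k l (u : dform R n k) (w : dform R n l) c :
  square_integrable T I u -> (forall A, continuous (w ^~ A)) ->
  integral_form T I (wedge u (fun x A => c * w x A)) =
  c * integral_form T I (wedge u w).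
Proof.
move=> uL2 w_cts; rewrite /integral_form /integral0.
rewrite -(RintegralZl _ mD) ?integrable_wedge //.
by apply: eq_Rintegral => y _; rewrite wedgeZr.
Qed.

Lemma integral_wedge0 k (u : dform R n k) (a : dform R n 0) :
  (forall x, alternating (u x)) -> square_integrable T I u ->
  constant_form a ->
  integral_form T I (wedge u a) = integral_form T I u * a (barycentre T I) 0.
Proof.
move=> ualt uL2 /constant_formP[_ acst]; rewrite /integral_form /integral0.
rewrite -(RintegralZr _ mD); last first.
  exact/square_integrable_integrable/conform0_sub.
apply: eq_Rintegral => y _; rewrite wedge_form0 //.
by rewrite usubmx0_castmx castmx_conform0 acst (acst (barycentre T I)).
Qed.

End Integrability.

(** * The recursion through the facets *)
Definition facet_rule (k l : nat) : form_op l.+1 l :=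
  OpScale ((-1) ^+ k / l.+1%:R) (OpOrientation
    (OpAdd (OpKappaCell l) (OpScale (-1) (OpKappaFacet l)))).

Section Moments.
Variables (R : realType) (n N : nat) (T : polytope R n N).
Implicit Types I J : {set 'I_N}.

Lemma apply_facet_rule I J k l (a : dform R n l.+1) :
  apply_op T I J (facet_rule k l) a = fun x A =>
    (-1) ^+ k / l.+1%:R * orientation T I J *
    (kappa T I a x A - kappa T J a x A).
Proof.
apply/funext => x; apply/funext => A /=.
rewrite fmorph_div rmorphXn rmorphN rmorph1 rmorph_nat.
by rewrite rmorphN1 mulN1r mulrA.
Qed.

(** The chart of a point is constant, its value is the barycentre, and there the
    vector field [x - b] is zero. *)
Lemma integral_form_point J k l (u : dform R n k) (a : dform R n l.+1) :
  cell_dim T J = 0%N -> constant_form a ->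
  integral_form T J (wedge u (kappa T J a)) = 0.
Proof.
move=> dimJ acst; pose o := #|J|%:R^-1 *: \sum_(i in J) vertex T i.
have chE y : @chart R n N T J y = o.
  rewrite /chart -[RHS]addr0; congr (_ + _).
  apply/rowP => j; rewrite !mxE big1 // => -[i lti] _.
  by exfalso; rewrite dimJ in lti.
pose m : R := fine (lebesgue_tuple R _ (@chart_dom R n N T J)).
have integralE g : integral0 T J g = g o * m.
  rewrite -Rintegral_cst; last exact: measurable_chart_dom.
  by apply: eq_Rintegral => y _; rewrite chE.
rewrite /integral_form integralE.
(* If the mass [m] were zero, the barycentre might differ from [o], but the
   integral would be zero too. *)
have [->|m0] := eqVneq m 0; first by rewrite mulr0.
have bary : barycentre T J = o.
  rewrite /barycentre integralE mul1r.
  have -> : \row_j integral0 T J (fun x => x 0 j) = m *: o.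
    by apply/rowP => j; rewrite [LHS]mxE [RHS]mxE integralE mulrC.
  by rewrite scalerA mulVf // scale1r.
rewrite /wedge big1 ?mulr0 ?mul0r // => s _.
rewrite /kappa bary contraction_constantE // subrr.
have [aalt _] := (constant_formP a).1 acst.
have := @alternating_col_mx_linear _ _ l _ (aalt 0)
  (dsubmx (row_perm s (conform_mx 0 (frame T J)))) 0 0 0 0.
by rewrite !scale0r addr0 !mul0r addr0 => ->; rewrite mulr0.
Qed.

(** The second orthogonality relation in the definition of [B^k(J)]; it is only
    imposed in positive dimension, whence the separate case of a point. *)
Lemma integral_kappa_facet J k l (u : space_X T J k) (a : dform R n l.+1) :
  space_B u -> cell_dim T J = (k + l)%N -> constant_form a ->
  integral_form T J (wedge u (kappa T J a)) = 0.
Proof.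
move=> uB dimJ acst; have [dimJ0|] := posnP (cell_dim T J).
  exact: integral_form_point.
move=> /uB[_ [_ u_kappa _]].
have el : ((cell_dim T J).+1 - k)%N = l.+1 by rewrite dimJ -addnS addKn.
by case: _ / el a acst => a; exact: u_kappa.
Qed.

Lemma integral_d_kappa I k l (u : space_X T I k) (a : dform R n l.+1) :
  space_B u -> cell_dim T I = (k + l.+1)%N -> constant_form a ->
  integral_form T I (wedge (xd u) (kappa T I a)) = 0.
Proof.
move=> uB dimI acst.
have /uB[_ [du_kappa _ _]] : (0 < cell_dim T I)%N by rewrite dimI addnS.
have el : (cell_dim T I - k)%N = l.+1 by rewrite dimI addKn.
by case: _ / el a acst => a; exact: du_kappa.
Qed.

Lemma constant_form_continuous l (a : dform R n l) A :
  constant_form a -> continuous (a ^~ A).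
Proof.
move=> /constant_formP[_ acst].
have -> : a ^~ A = (fun=> a 0 A) by apply/funext => x; rewrite acst.
exact: cst_continuous.
Qed.

(** Stokes' formula with the contraction of [a] as test form; see the
    introduction. *)
Lemma moment_facets I k l (u : space_X T I k)
    (h : forall J, space_X T J k) (a : dform R n l.+1) :
  face T I -> cell_dim T I = (k + l.+1)%N -> has_trace u (fun J => h J) ->
  space_B u -> (forall J, facet T I J -> space_B (h J)) -> constant_form a ->
  integral_form T I (wedge u a) =
    \sum_(J : {set 'I_N} | `[< facet T I J >])
      integral_form T J (wedge (h J) (apply_op T I J (facet_rule k l) a)).
Proof.
move=> faceI dimI u_trace uB hB acst.
have kappa_smooth J : smooth_form (kappa T J a) by exact: smooth_contraction.
have kappa_cts J A : continuous (kappa T J a ^~ A).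
  by have [_ /(_ A 0%N)] := kappa_smooth J.
have stokes := u_trace _ _
  (etrans (esym (addnS k l)) (esym dimI)) (kappa_smooth I).
rewrite integral_d_kappa // add0r ext_deriv_contraction // in stokes.
rewrite integral_wedgeZr // in stokes; first last.
- by move=> A; exact: constant_form_continuous.
- exact: xval_L2.
have {stokes} -> : integral_form T I (wedge u a) = (-1) ^+ k / l.+1%:R *
    \sum_(J : {set 'I_N} | `[< facet T I J >])
      orientation T I J * integral_form T J (wedge (h J) (kappa T I a)).
  by rewrite -stokes mulrACA -expr2 sqrr_sign mul1r mulKf.
rewrite big_distrr; apply: eq_bigr => J /asboolP IJ; rewrite apply_facet_rule.
have [_ faceJ _ dimJ] := IJ.
have {}dimJ : cell_dim T J = (k + l)%N.
  by apply/eq_add_S; rewrite -addnS -dimI.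
have D_cst := constant_contractionB acst 1 (barycentre T I) (barycentre T J).
have kappaE : kappa T I a = fun x A =>
    1 * (kappa T I a x A - kappa T J a x A) + kappa T J a x A.
  by apply/funext => x; apply/funext => A; rewrite mul1r subrK.
rewrite [X in wedge (h J) X]kappaE integral_wedgeDr //; first last.
- by move=> A; exact: constant_form_continuous D_cst.
- exact: xval_L2.
rewrite (integral_kappa_facet (hB J IJ) dimJ acst) addr0 [LHS]mulrA.
(* The factor is put back inside the integral to get the rule itself. *)
rewrite -integral_wedgeZr //; first last.
- by move=> A; exact: constant_form_continuous D_cst.
- exact: xval_L2.
congr (integral_form T J (wedge _ _)).
by apply/funext => x; apply/funext => A; rewrite mul1r.
Qed.

End Moments.

(* The first part is the recursion, on the faces I of dimension k + l + 1; the
   second part is its result on T, starting from the degrees of freedom of u. *)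
Theorem proposition2p10 (R : realType) :
  exists rule : forall k l : nat, form_op l.+1 l,
  forall (n N : nat) (T : polytope R n N.+1) (k : nat)
    (u : space_X T (whole N.+1) k)
    (tr : forall I : {set 'I_N.+1}, space_X T I k),
  space_A u tr ->
  (forall (l : nat) (I : {set 'I_N.+1}) (a : dform R n l.+1),
     face T I -> cell_dim T I = (k + l.+1)%N -> constant_form a ->
     (forall J : {set 'I_N.+1}, facet T I J ->
        constant_form (apply_op T I J (rule k l) a)) /\
     integral_form T I (wedge (tr I) a) =
       \sum_(J : {set 'I_N.+1} | `[< facet T I J >])
         integral_form T J (wedge (tr J) (apply_op T I J (rule k l) a))) /\
  (forall (l : nat) (a' : dform R n l),
     cell_dim T (whole N.+1) = (k + l)%N -> constant_form a' ->
     integral_form T (whole N.+1) (wedge u a') =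
       recursive_moment T (rule k) (fun J => integral_form T J (tr J))
         (whole N.+1) a').
Proof.
exists facet_rule => n N T k u tr [[tr_whole tr_trace] trB].
have rule_cst l I J (a : dform R n l.+1) : constant_form a ->
    constant_form (apply_op T I J (facet_rule k l) a).
  by move=> acst; rewrite apply_facet_rule; exact: constant_contractionB.
have step l I (a : dform R n l.+1) : face T I ->
    cell_dim T I = (k + l.+1)%N -> constant_form a ->
    integral_form T I (wedge (tr I) a) =
    \sum_(J : {set 'I_N.+1} | `[< facet T I J >])
      integral_form T J (wedge (tr J) (apply_op T I J (facet_rule k l) a)).
  move=> faceI dimI acst; apply: moment_facets => //.
  - exact: tr_trace.
  - exact: trB.
  - by move=> J [_ faceJ _ _]; exact: trB.
split=> [l I a faceI dimI acst|l a dimT acst].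
  by split; [move=> J _; exact: rule_cst|exact: step].
have face_whole : face T (whole N.+1).
  split; first by apply/set0Pn; exists ord0; rewrite inE.
  by exists 0, 0 => i; rewrite mulmx0 mxE lexx eqxx inE.
rewrite -tr_whole.
elim: l (whole _) a face_whole dimT acst => [|l IHl] I a faceI dimI acst.
  apply: integral_wedge0 => //; first exact: xval_alternating.
  exact: xval_L2.
rewrite step //=; apply: eq_bigr => J /asboolP[_ faceJ _ dimJ].
apply: IHl => //; last exact: rule_cst.
by apply/eq_add_S; rewrite -addnS -dimI.
Qed.
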